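(* For each integer $n \geq 0$, we have $T_2(n, -1) = (-1)^{t(n)} S(n + 1, -2)$, where $T_2(n,x) = \sum_{m=0}^{n} x^{\nu_2\left(\binom{n}{m}\right)}$, $t(n)$ is the $n$th term of the Thue--Morse sequence, and $S(n,x)$ is the $n$th Stern polynomial.
   Context: $\nu_2(N)$ denotes the $2$-adic valuation of a positive integer $N$ (exponent of the highest power of $2$ dividing $N$). The Thue--Morse sequence is $t(n) = $ (number of $1$s in the binary representation of $n$) $\bmod 2$. The Stern polynomial $S(n,x)$ for $n \ge 0$ is defined as follows: if $n_\ell \cdots n_1 n_0$ is the standard base-$2$ representation of $n$ (empty for $n=0$, giving the empty matrix product), then \[ S(n, x) = \begin{bmatrix} 1 & 0 \end{bmatrix} A(n_0) \, A(n_1) \, \cdots \, A(n_\ell) \begin{bmatrix} 0 \\ 1 \end{bmatrix},\quad A(0) = \begin{bmatrix} x & 0 \\ 1 & 1 \end{bmatrix},\ A(1) = \begin{bmatrix} 1 & 1 \\ 0 & x \end{bmatrix}. \] *)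

(* Defs.v *)
From mathcomp Require Import all_boot all_order all_algebra.
Set Implicit Arguments.
Unset Strict Implicit.
Unset Printing Implicit Defensive.
Import GRing.Theory.
Local Open Scope ring_scope.

(* Binary digits [:: n_0; n_1; ...; n_l], least significant first, with
   n_l = 1; up_log 2 n.+1 is the number of digits, and is 0 for n = 0. *)
Definition bits (n : nat) : seq bool :=
  mkseq (fun i => odd (n %/ 2 ^ i)) (up_log 2 n.+1).

Lemma bits0 : bits 0 = [::].
Proof. by rewrite /bits up_log1. Qed.

Lemma bits_rec (n : nat) : (0 < n)%N -> bits n = odd n :: bits n./2.
Proof.
move=> n_gt0; rewrite /bits up_log2S // /mkseq /= expn0 divn1.
congr cons; rewrite (iotaDl 1 0) -map_comp; apply: eq_map => i /=.
by rewrite add1n expnS divnMA divn2.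
Qed.

Definition thue_morse (n : nat) : nat := (count id (bits n) %% 2)%N.

Definition stern_mx (b : bool) : 'M[{poly int}]_2 :=
  \matrix_(i, j) (nth [::] (if b then [:: [:: 1; 1]; [:: 0; 'X]]
                                 else [:: [:: 'X; 0]; [:: 1; 1]]) i)`_j.

Definition stern_poly (n : nat) : {poly int} :=
  ((\row_j [:: 1; 0]`_j) *m (\prod_(b <- bits n) stern_mx b)
     *m (\col_i [:: 0; 1]`_i)) 0 0.

Definition T2 (n : nat) : {poly int} :=
  \sum_(0 <= m < n.+1) 'X^(logn 2 'C(n, m)).

(* Main.v *)
Require Import Defs.
From mathcomp Require Import all_boot all_order all_algebra.
From mathcomp Require Import zify ring.
Set Implicit Arguments.
Unset Strict Implicit.
Unset Printing Implicit Defensive.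
Import GRing.Theory.
Local Open Scope ring_scope.

(** Both sides satisfy the same recurrence. The column vector produced by the
    matrix product for [n] is [(S(n), S(n+1))], whence [S(2n) = x S(n)] and
    [S(2n+1) = S(n) + S(n+1)]. Splitting the row sum by the parity of [m] gives
    [T(2k+1) = 2 T(k)] and [T(2k) = T(k) - (-1)^nu(k) T(k-1)] at [x = -1], the
    second because [nu C(2k, 2j+1) = 1 + nu(k) + nu C(k-1, j)]. The two match
    since [t(k-1) = t(k) - 1 + nu(k) mod 2]. *)

Lemma bits_double (n : nat) : (0 < n)%N -> bits n.*2 = false :: bits n.
Proof. by move=> n0; rewrite bits_rec ?double_gt0 // odd_double doubleK. Qed.

Lemma bits_doubleS (n : nat) : bits n.*2.+1 = true :: bits n.
Proof. by rewrite bits_rec //= odd_double /= uphalf_double. Qed.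

(** Induction along the binary expansion, one least significant digit at a time. *)
Lemma half_ind (P : nat -> Prop) :
    P 0%N -> (forall n, (0 < n)%N -> P n -> P n.*2) ->
  (forall n, P n -> P n.*2.+1) -> forall n, P n.
Proof.
move=> P0 Pe Po n; have [m] := ubnP n; elim: m n => // m IH n.
rewrite -{2}(odd_double_half n) -[in X in X -> _](odd_double_half n).
case: (odd n) => /= ltnm; first by apply: Po; apply: IH; lia.
by case: (posnP n./2) => [->|h0] //; apply: Pe => //; apply: IH; lia.
Qed.

Lemma mulmx_col2 (R : pzRingType) (m : nat) (A : 'M[R]_(m, 2)) (v : 'cV_2)
    (i : 'I_m) :
  (A *m v) i 0 = A i 0 * v 0 0 + A i 1 * v 1 0.
Proof.
rewrite mxE big_ord_recl big_ord1.
by have -> : lift ord0 ord0 = 1 :> 'I_2 by apply: val_inj.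
Qed.

(** The row vector is dropped so that a new lowest digit acts by one left multiplication. *)
Definition stern_col (n : nat) : 'cV[{poly int}]_2 :=
  (\prod_(b <- bits n) stern_mx b) *m (\col_i [:: 0; 1]`_i).

Lemma stern_polyE (n : nat) : stern_poly n = stern_col n 0 0.
Proof.
by rewrite /stern_poly -mulmxA mulmx_col2 !mxE /= mul1r mul0r addr0.
Qed.

Lemma stern_col_cons (n m : nat) (b : bool) : bits n = b :: bits m ->
  stern_col n = stern_mx b *m stern_col m.
Proof. by move=> nE; rewrite /stern_col nE big_cons mulmxA. Qed.

Lemma stern_col00 : stern_col 0 0 0 = 0.
Proof. by rewrite /stern_col bits0 big_nil mul1mx mxE. Qed.

Lemma stern_col01 : stern_col 0 1 0 = 1.
Proof. by rewrite /stern_col bits0 big_nil mul1mx mxE. Qed.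

Lemma stern_col_double0 (n : nat) : stern_col n.*2 0 0 = 'X * stern_col n 0 0.
Proof.
case: (posnP n) => [->|n0]; first by rewrite stern_col00 mulr0.
rewrite (stern_col_cons (bits_double n0)) mulmx_col2 !mxE /=.
by rewrite mul0r addr0.
Qed.

Lemma stern_col_double1 (n : nat) :
  stern_col n.*2 1 0 = stern_col n 0 0 + stern_col n 1 0.
Proof.
case: (posnP n) => [->|n0]; first by rewrite stern_col00 add0r.
rewrite (stern_col_cons (bits_double n0)) mulmx_col2 !mxE /=.
by rewrite !mul1r.
Qed.

Lemma stern_col_doubleS0 (n : nat) :
  stern_col n.*2.+1 0 0 = stern_col n 0 0 + stern_col n 1 0.
Proof.
rewrite (stern_col_cons (bits_doubleS n)) mulmx_col2 !mxE /=.
by rewrite !mul1r.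
Qed.

Lemma stern_col_doubleS1 (n : nat) :
  stern_col n.*2.+1 1 0 = 'X * stern_col n 1 0.
Proof.
rewrite (stern_col_cons (bits_doubleS n)) mulmx_col2 !mxE /=.
by rewrite mul0r add0r.
Qed.

(** The lower entry at [n] and the upper entry at [n.+1] obey the same recurrence; only the odd
    case, where [n.+1] becomes [n.+1.*2], needs the induction hypothesis. *)
Lemma stern_col1 (n : nat) : stern_col n 1 0 = stern_poly n.+1.
Proof.
rewrite stern_polyE; elim/half_ind: n => [|n _ _|n IHn].
- by rewrite stern_col01 (stern_col_doubleS0 0) stern_col00 stern_col01 add0r.
- by rewrite stern_col_double1 stern_col_doubleS0.
- by rewrite stern_col_doubleS1 IHn -doubleS stern_col_double0.
Qed.

Lemma stern_poly1 : stern_poly 1 = 1.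
Proof. by rewrite -stern_col1 stern_col01. Qed.

Lemma stern_poly_double (n : nat) : stern_poly n.*2 = 'X * stern_poly n.
Proof. by rewrite !stern_polyE stern_col_double0. Qed.

Lemma stern_poly_doubleS (n : nat) :
  stern_poly n.*2.+1 = stern_poly n + stern_poly n.+1.
Proof. by rewrite -!stern_col1 stern_polyE stern_col_double1. Qed.

Lemma thue_morse_signE (n : nat) :
  (-1) ^+ thue_morse n = (-1) ^+ count id (bits n) :> int.
Proof. by rewrite /thue_morse modn2 signr_odd. Qed.

Lemma thue_morse_sign_double (n : nat) :
  (-1) ^+ thue_morse n.*2 = (-1) ^+ thue_morse n :> int.
Proof.
by case: (posnP n) => [->|n0] //; rewrite !thue_morse_signE bits_double.
Qed.

Lemma thue_morse_sign_doubleS (n : nat) :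
  (-1) ^+ thue_morse n.*2.+1 = - (-1) ^+ thue_morse n :> int.
Proof. by rewrite !thue_morse_signE bits_doubleS /= exprS mulN1r. Qed.

Lemma logn2_double (n : nat) : (0 < n)%N -> logn 2 n.*2 = (logn 2 n).+1.
Proof. by move=> n0; rewrite -mul2n lognM // logn_prime. Qed.

Lemma logn2_doubleS (n : nat) : logn 2 n.*2.+1 = 0%N.
Proof. by apply: logn_coprime; rewrite coprime2n /= odd_double. Qed.

(** Adding 1 clears the [logn 2 n.+1] trailing ones of [n] and sets the zero above them, so the
    digit sum changes by [1 - logn 2 n.+1]. *)
Lemma thue_morse_sign_succ (n : nat) :
  (-1) ^+ thue_morse n.+1 =
  - (-1) ^+ logn 2 n.+1 * (-1) ^+ thue_morse n :> int.
Proof.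
elim/half_ind: n => [|n _ _|n IHn].
- by rewrite (thue_morse_sign_doubleS 0) logn1 mulN1r.
- by rewrite thue_morse_sign_doubleS thue_morse_sign_double logn2_doubleS mulN1r.
- rewrite -doubleS thue_morse_sign_double thue_morse_sign_doubleS.
  by rewrite logn2_double // exprS IHn; ring.
Qed.

Lemma logn2_fact_double (n : nat) : logn 2 n.*2`! = (n + logn 2 n`!)%N.
Proof.
elim: n => // n IHn; rewrite doubleS 2!factS [in RHS]factS.
rewrite !lognM ?muln_gt0 ?fact_gt0 // -doubleS logn2_double // logn2_doubleS.
by rewrite IHn; lia.
Qed.

Lemma logn2_fact_doubleS (n : nat) : logn 2 n.*2.+1`! = (n + logn 2 n`!)%N.
Proof. by rewrite factS lognM ?fact_gt0 // logn2_doubleS logn2_fact_double. Qed.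

(** The additive form reduces the valuations of binomials below to linear arithmetic. *)
Lemma logn_bin_fact (p n m : nat) : (m <= n)%N ->
  (logn p 'C(n, m) + logn p m`! + logn p (n - m)`!)%N = logn p n`!.
Proof.
move=> le_mn; rewrite -(bin_fact le_mn).
by rewrite !lognM ?muln_gt0 ?bin_gt0 ?fact_gt0 // addnA.
Qed.

(** Doubling adds [n] to the valuation of the numerator and [m + (n - m)] to that of the
    denominator, which cancel. The next two lemmas rest on the same cancellation. *)
Lemma logn2_bin_double_double (n m : nat) : (m <= n)%N ->
  logn 2 'C(n.*2, m.*2) = logn 2 'C(n, m).
Proof.
move=> le_mn; have := logn_bin_fact 2 le_mn.
have := @logn_bin_fact 2 n.*2 m.*2 _; rewrite leq_double => /(_ le_mn).
by rewrite -doubleB !logn2_fact_double; lia.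
Qed.

Lemma logn2_bin_doubleS_double (n m : nat) : (m <= n)%N ->
  logn 2 'C(n.*2.+1, m.*2) = logn 2 'C(n, m).
Proof.
move=> le_mn; have := logn_bin_fact 2 le_mn.
have := @logn_bin_fact 2 n.*2.+1 m.*2 ltac:(lia).
have -> : (n.*2.+1 - m.*2 = (n - m).*2.+1)%N by lia.
by rewrite !logn2_fact_doubleS !logn2_fact_double; lia.
Qed.

Lemma logn2_bin_doubleS_doubleS (n m : nat) : (m <= n)%N ->
  logn 2 'C(n.*2.+1, m.*2.+1) = logn 2 'C(n, m).
Proof.
move=> le_mn; have := logn_bin_fact 2 le_mn.
have := @logn_bin_fact 2 n.*2.+1 m.*2.+1 ltac:(lia).
rewrite subSS -doubleB.
by rewrite !logn2_fact_doubleS !logn2_fact_double; lia.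
Qed.

(** Here the numerator gains [n.+1] but the denominator only [m + (n - m) = n], which leaves the
    extra 1; [logn 2 n.+1] comes from passing from [n.+1] factorial to [n] factorial. *)
Lemma logn2_bin_double_doubleS (n m : nat) : (m <= n)%N ->
  logn 2 'C(n.+1.*2, m.*2.+1) = (logn 2 n.+1 + logn 2 'C(n, m)).+1.
Proof.
move=> le_mn; have := logn_bin_fact 2 le_mn.
have := @logn_bin_fact 2 n.+1.*2 m.*2.+1 ltac:(lia).
have -> : (n.+1.*2 - m.*2.+1 = (n - m).*2.+1)%N by lia.
rewrite !logn2_fact_doubleS logn2_fact_double factS lognM ?fact_gt0 //.
by lia.
Qed.

Lemma big_nat_double (V : nmodType) (F : nat -> V) (n : nat) :
  \sum_(0 <= i < n.*2) F i =
  \sum_(0 <= i < n) F i.*2 + \sum_(0 <= i < n) F i.*2.+1.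
Proof.
elim: n => [|n IHn]; first by rewrite !big_geq // addr0.
by rewrite doubleS !big_nat_recr //= IHn -addrA addrACA.
Qed.

Lemma T2_doubleS (n : nat) : T2 n.*2.+1 = T2 n *+ 2.
Proof.
rewrite /T2 -doubleS big_nat_double mulr2n.
congr (_ + _); apply: eq_big_nat => i /andP[_ lt_in].
- by rewrite logn2_bin_doubleS_double.
- by rewrite logn2_bin_doubleS_doubleS.
Qed.

Lemma T2_double (n : nat) :
  T2 n.+1.*2 = T2 n.+1 + 'X^((logn 2 n.+1).+1) * T2 n.
Proof.
(* The row has an odd number of entries; the last one is split off and grouped with those of even
   index. *)
rewrite /T2 big_nat_recr //= big_nat_double addrAC.
rewrite [in RHS]big_nat_recr //= !binn big_distrr /=.
congr (_ + _ + _); apply: eq_big_nat => i /andP[_ lt_in].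
- by rewrite logn2_bin_double_double // ltnW.
- by rewrite logn2_bin_double_doubleS // -addSn exprD.
Qed.

Lemma T2_0 : T2 0 = 1.
Proof. by rewrite /T2 big_nat1 bin0 logn1. Qed.

Theorem theorem2 (n : nat) :
  (T2 n).[-1] = (-1) ^+ thue_morse n * (stern_poly n.+1).[-2].
Proof.
have [m] := ubnP n; elim: m n => // m IH n.
rewrite -[n in (n < _)%N]odd_double_half -[n in T2 n]odd_double_half.
rewrite -[n in thue_morse n]odd_double_half -[n in stern_poly n.+1]odd_double_half.
case: (odd n) => /=; move: n./2 => k lt_km.
  (* The sign flip turns the factor ['X], evaluated at -2, into the 2 of [T2_doubleS]. *)
  rewrite add1n T2_doubleS -doubleS stern_poly_double thue_morse_sign_doubleS.
  by rewrite hornerMn hornerM hornerX IH; [ring | lia].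
(* The even recurrence reaches back to two smaller rows, so [n = 0] is treated apart. *)
rewrite add0n in lt_km *; case: k => [|k] in lt_km *.
  by rewrite T2_0 stern_poly1 /thue_morse bits0 !hornerE.
rewrite T2_double stern_poly_doubleS thue_morse_sign_double !hornerD hornerM.
rewrite hornerXn !IH; [|lia..].
(* The terms in [stern_poly k.+2] agree; those in [stern_poly k.+1] differ only by the sign relating
   [thue_morse k.+1] to [thue_morse k]. *)
rewrite mulrDr [in RHS]addrC; congr (_ + _).
by rewrite thue_morse_sign_succ exprS; ring.
Qed.
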